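(* Let $(\Theta,\Sigma_\Theta)$ and $(\mathcal Y,\Sigma_{\mathcal Y})$ be Borel spaces, let $\pi$ be a prior probability measure on $\Theta$, and let $\{P_\theta\}_{\theta\in\Theta}$ be probability measures on $\mathcal Y$ (a Markov kernel). Let $X\sim\pi$ be the hidden parameter and $Y$ an observation with $Y\mid X=\theta \sim P_\theta$. Let $\beta:\Theta\to\mathbb R$ be the parameter of interest and $\check\beta:\mathcal Y\to\mathbb R$ any (measurable) estimator. Let $D:\mathbb R_+\to\mathbb R_+$, $\mathbb R_+=[0,\infty)$, satisfy $D(x)\ge D(y)$ whenever $x\ge y$, $D(0)=0$, and $D$ differentiable with derivative $\dot D$. Define the Bayesian error $$\mathsf E \equiv \mathbb E\{D[|\check\beta(Y)-\beta(X)|]\}.$$ For each $t\in\mathbb R_+$, let $\Phi_t,\Phi_t'\in\Sigma_\Theta$, let $\Sigma_t\equiv\{S\cap\Phi_t: S\in\Sigma_\Theta\}$ and $\Sigma_t'\equiv\{S\cap\Phi_t': S\in\Sigma_\Theta\}$ be the restricted $\sigma$-algebras, and let $T_t:\Phi_t\to\Phi_t'$ be a $\Sigma_t/\Sigma_t'$-measurable map such that there exists a measure $\pi_t$ on $(\Phi_t,\Sigma_t)$ satisfying $$\pi = \pi_t T_t^{-1}\quad\text{on }(\Phi_t',\Sigma_t'),$$ and $$\beta(T_t(\theta))\ge \beta(\theta)+t\quad\text{for }\pi_t\text{-almost every }\theta\in\Phi_t.$$ Assume further that both $\pi$ and $\pi_t$ are dominated by a reference measure $\mu$ on $(\Phi_t,\Sigma_t)$,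 with densities $f\equiv d\pi/d\mu$ and $f_t\equiv d\pi_t/d\mu$. Then $$\mathsf E\ge \mathsf Z_1\equiv \frac12\int_0^\infty dt\,\dot D\!\left(\frac t2\right)\mathcal V g_1(t),\qquad g_1(t)\equiv\int_{\Phi_t} d\mu(\theta)\,[f(\theta)+f_t(\theta)]\,\Pi\!\left(\theta,T_t(\theta),\frac{f(\theta)}{f(\theta)+f_t(\theta)}\right),$$ and also $$\mathsf E\ge \mathsf Z_2\equiv \frac12\int_0^\infty dt\,\dot D\!\left(\frac t2\right)\mathcal V g_2(t),\qquad g_2(t)\equiv 2\int_{\Phi_t} d\mu(\theta)\,\min\{f(\theta),f_t(\theta)\}\,\Pi\!\left(\theta,T_t(\theta),0.5\right).$$
   Context: For $\theta,\phi\in\Theta$ and $q\in[0,1]$, $\Pi(\theta,\phi,q)$ denotes the minimum error probability (minimized over all decision rules based on $Y$) for the binary hypothesis-testing problem with hypotheses $\mathcal H_0: Y\sim P_\theta$ and $\mathcal H_1: Y\sim P_\phi$, where $\mathcal H_0$ has prior probability $q$ and $\mathcal H_1$ has prior probability $1-q$. The valley-filling operator $\mathcal V$ acts on a function $g$ on $\mathbb R_+$ by $\mathcal V g(t)\equiv\sup_{t'\ge t} g(t')$. The measure $\pi_t$ need not be a probability measure. $\pi_tT_t^{-1}$ denotes the pushforward of $\pi_t$ under $T_t$. *)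

(* Defs.v *)
From HB Require Import structures.
From mathcomp Require Import all_boot all_order all_algebra.
From mathcomp Require Import all_classical all_reals all_analysis.
Set Implicit Arguments.
Unset Strict Implicit.
Unset Printing Implicit Defensive.
Import Order.TTheory GRing.Theory Num.Theory.
Import numFieldNormedType.Exports.
Local Open Scope classical_set_scope.
Local Open Scope ring_scope.

Definition borel_space (R : realType) d (T : measurableType d) : Prop :=
  exists g : T -> R,
    [/\ injective g, measurable_fun setT g, measurable (range g)
      & forall A : set T, measurable A -> measurable (g @` A)].

(* Minimum error probability for H0 : Y ~ P theta (prior q) vs
   H1 : Y ~ P phi (prior 1-q), minimized over all (measurable) decision rules;
   the rule decides H1 exactly on the measurable set A. *)
Definition min_err (R : realType) d1 d2 (Th : measurableType d1)
  (Yt : measurableType d2) (P : R.-pker Th ~> Yt) (theta phi : Th) (q : R)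
  : \bar R :=
  ereal_inf [set ((q%:E * P theta A) + ((1 - q)%:E * P phi (~` A)))%E
            | A in [set A : set Yt | measurable A]].

Definition valley_fill (R : realType) (g : R -> \bar R) (t : R) : \bar R :=
  ereal_sup [set g t' | t' in `[t, +oo[%classic].

(* Main.v *)
Require Import Defs.
From HB Require Import structures.
From mathcomp Require Import all_boot all_order all_algebra.
From mathcomp Require Import all_classical all_reals all_analysis.
From mathcomp Require Import measurable_realfun measurable_fun_approximation lra.
Import Order.TTheory GRing.Theory Num.Theory.
Import numFieldNormedType.Exports.
Local Open Scope classical_set_scope.
Local Open Scope ring_scope.

(** Write the risk as an integral of the tail probabilities
    h t = Pr (|betac Y - beta X| >= t / 2): since D is nondecreasing with D 0 = 0,
    D e >= 1/2 \int_0^{2e} D'(t/2) dt, so Tonelli gives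
    E >= 1/2 \int_0^oo D'(t/2) h t dt. Splitting the tail event into overestimation
    by t/2 at theta and underestimation by t/2 at T theta turns the estimator into a
    test of theta against T theta, so h t >= g_i t; and h is nonincreasing,
    so it dominates the valley-filled g_i as well. *)

(** * Integration: majorants, weighted images, Tonelli for kernels *)

Section general_integration.
Local Open Scope ereal_scope.
Import HBNNSimple.

(** Meant for integrands whose measurability is unknown, such as those built from [min_err] or
    [valley_fill]. The integral of the positive part is a supremum over simple functions below it,
    and each of these is measurable and lies almost everywhere below [g]. *)
Lemma le_integral_ae_majorant (d : measure_display) (T : measurableType d)
    (R : realType) (mu : {measure set T -> \bar R}) (D : set T)
    (f g : T -> \bar R) : measurable D -> measurable_fun D g ->
  (forall x, D x -> 0 <= g x) -> {ae mu, forall x, D x -> f x <= g x} ->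
  \int[mu]_(x in D) f x <= \int[mu]_(x in D) g x.
Proof.
move=> mD mg g0 fg; rewrite integralE.
apply: (@le_trans _ _ (\int[mu]_(x in D) f^\+ x)).
  by rewrite -[leRHS]sube0 leeB ?integral_ge0.
rewrite ge0_integralE//; apply: ge_ereal_sup => _ [h /= hf <-].
rewrite -integralT_nnsfun [leRHS]integral_mkcond.
apply: ae_ge0_le_integral => //.
- by move=> x _; rewrite lee_fin.
- exact/measurable_EFinP.
- by move=> x _; rewrite erestrict_ge0.
- exact/(measurable_restrictT _ mD).1.
move: fg; apply: filterS => x fgx _; apply: (le_trans (hf x)).
rewrite /patch; case: ifPn => // /[1!inE] Dx.
by rewrite funeposE ge_max fgx//= g0.
Qed.

(** Change of variables when [nu] is the image under [phi] of the measure with density [w] on [D].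
    Monotone convergence on both sides reduces it to simple functions. *)
Lemma ge0_integral_weighted_image (d1 d2 : measure_display) (X : measurableType d1)
    (Y : measurableType d2) (R : realType) (m : {measure set X -> \bar R})
    (nu : {measure set Y -> \bar R}) (D : set X) (phi : X -> Y) (w : X -> R)
    (h : Y -> \bar R) :
  measurable D -> measurable_fun D phi -> measurable_fun D w ->
  (forall x, D x -> (0 <= w x)%R) ->
  (forall S, measurable S ->
     nu S = \int[m]_(x in D `&` phi @^-1` S) (w x)%:E) ->
  measurable_fun setT h -> (forall y, 0 <= h y) ->
  \int[nu]_y h y = \int[m]_(x in D) ((w x)%:E * h (phi x)).
Proof.
move=> mD mphi mw w0 nuE mh h0.
have mew : measurable_fun D (EFin \o w) by exact/measurable_EFinP.
pose h_ := nnsfun_approx measurableT mh.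
have ch y : (h_ n y)%:E @[n --> \oo] --> h y.
  by apply: cvg_nnsfun_approx.
have ndh y : {homo (fun n => h_ n y) : a b / (a <= b)%N >-> (a <= b)%R}.
  by move=> a b ab; exact/lefP/nd_nnsfun_approx.
transitivity (limn (fun n => \int[nu]_y (h_ n y)%:E)).
  rewrite -monotone_convergence//.
  - by apply: eq_integral => y _; apply/esym/cvg_lim.
  - by move=> n; exact/measurable_EFinP/measurable_funP.
  - by move=> n y _; rewrite lee_fin.
  - by move=> y _ a b ab; rewrite lee_fin; exact: ndh.
have mcomp (g : Y -> R) : measurable_fun setT g -> measurable_fun D (g \o phi).
  by move=> mg; apply: measurableT_comp.
rewrite [X in limn X](_ : _ =
    (fun n => \int[m]_(x in D) ((w x)%:E * (h_ n (phi x))%:E))).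
  rewrite -monotone_convergence//.
  - apply: eq_integral => x /[!inE] Dx; apply/cvg_lim => //.
    by apply: cvgeZl => //.
  - move=> n; apply: emeasurable_funM => //.
    exact/measurable_EFinP/(mcomp (h_ n)).
  - by move=> n x Dx; rewrite mule_ge0 ?lee_fin ?w0.
  - move=> x Dx a b ab; rewrite lee_wpmul2l ?lee_fin ?w0//; exact: ndh.
apply/funext => n.
have mpre r : measurable (h_ n @^-1` [set r]) by exact: measurable_funPTI.
rewrite integralT_nnsfun sintegralE.
(* On a single level set the identity is the hypothesis [nuE]; additivity then reassembles the
   simple function from its finitely many levels. *)
transitivity (\sum_(r \in range (h_ n))
   \int[m]_(x in D) ((w x)%:E * (r * \1_(h_ n @^-1` [set r]) (phi x))%:E)).
  apply: eq_fsbigr => r; rewrite inE => -[y _ ry].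
  have r0 : (0 <= r)%R by rewrite -ry.
  rewrite nuE// setIC integral_mkcondl.
  have mA : measurable_fun D (fun x => \1_(h_ n @^-1` [set r]) (phi x) : R).
    by apply: (mcomp (\1_(h_ n @^-1` [set r]))); exact: measurable_indic.
  rewrite (eq_integral
    (fun x => (w x)%:E * (\1_(h_ n @^-1` [set r]) (phi x))%:E)); last first.
    move=> x _; rewrite /patch/= indicE.
    have -> : (x \in phi @^-1` (h_ n @^-1` [set r])) =
              (phi x \in h_ n @^-1` [set r]) by apply/idP/idP; rewrite !inE.
    by case: ifPn; rewrite ?mule1 ?mule0.
  rewrite -ge0_integralZl//.
  - by apply: eq_integral => x _; rewrite muleCA -EFinM.
  - by apply: emeasurable_funM => //; exact/measurable_EFinP.
  - by move=> x Dx; rewrite mule_ge0 ?lee_fin ?w0.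
rewrite -ge0_integral_fsum//.
- apply: eq_integral => x _.
  rewrite fimfunE -fsumEFin// ge0_mule_fsumr//.
  by move=> r; rewrite nnfun_muleindic_ge0.
- move=> r; apply: emeasurable_funM => //; apply/measurable_EFinP.
  apply: measurable_funM => //.
  by apply: (mcomp (\1_(h_ n @^-1` [set r]))); exact: measurable_indic.
- move=> r x Dx; rewrite mule_ge0 ?lee_fin ?w0//.
  exact: nnfun_muleindic_ge0.
Qed.

(** [P] is viewed as a kernel from the product that ignores the [T0] coordinate, so that
    measurability of integrals against finite kernels applies. *)
Lemma measurable_integral_kernel_snd (d0 d1 d2 : measure_display) (T0 : measurableType d0)
    (T1 : measurableType d1) (T2 : measurableType d2) (R : realType)
    (P : R.-spker T1 ~> T2) (k : T0 * T1 * T2 -> \bar R) :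
  measurable_fun setT k -> (forall z, 0 <= k z) ->
  measurable_fun setT (fun z : T0 * T1 => \int[P z.2]_y k (z, y)).
Proof.
move=> mk k0.
pose l : R.-fker (T0 * T1) ~> T2 := @kernel.kernel_snd d0 d1 d2 T0 T1 T2 R P.
exact: (@measurable_fun_integral_finite_kernel _ _ _ _ _ k l k0 mk).
Qed.

(** Two exchanges move [t] innermost: first with [x], by Tonelli for [m0] and [m1], then with [y] at
    fixed [x], by Tonelli for [m0] and [P x]. *)
Lemma tonelli_kernel (d0 d1 d2 : measure_display) (T0 : measurableType d0)
    (T1 : measurableType d1) (T2 : measurableType d2) (R : realType)
    (m0 : {sigma_finite_measure set T0 -> \bar R})
    (m1 : {sigma_finite_measure set T1 -> \bar R}) (P : R.-spker T1 ~> T2)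
    (k : T0 * T1 * T2 -> \bar R) :
  measurable_fun setT k -> (forall z, 0 <= k z) ->
  \int[m0]_t \int[m1]_x \int[P x]_y k (t, x, y) =
  \int[m1]_x \int[P x]_y \int[m0]_t k (t, x, y).
Proof.
move=> mk k0; have mi := measurable_integral_kernel_snd _ _ _ _ _ _ _ P _ mk k0.
rewrite (fubini_tonelli _ mi)//; last first.
  by move=> z; exact: integral_ge0.
apply: eq_integral => x _.
(* The finite measure [P x] is repackaged as a sigma-finite one, the structure that Tonelli
   expects. *)
have sfP : sigma_finite setT (P x).
  apply: fin_num_fun_sigma_finite; first by rewrite measure0.
  exact: finite_kernel_measure.
pose F1 := isSFinite.Build _ _ _ _ (sfinite_measure_sigma_finite sfP).
pose F2 := isSigmaFinite.Build _ _ _ _ sfP.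
pose Px := HB.pack_for (SigmaFiniteMeasure.type T2 R) (Measure.sort (P x)) F1 F2.
have -> : P x = Px by exact: eq_measure.
rewrite (@fubini_tonelli _ _ _ _ _ m0 Px (fun z => k (z.1, x, z.2)))//.
apply: (measurableT_comp mk).
by apply: measurable_fun_pair => //; apply: measurable_fun_pair.
Qed.

End general_integration.

(** * Derivative of a nondecreasing function and the integral inequality for it *)

Section monotone_derivative.
Context (R : realType) (F : R -> R).
Hypotheses (cF : continuous F) (ndF : {homo F : x y / (x <= y)%R})
  (dF : forall x : R, 0 < x -> derivable F x 1).

(** Difference quotient with step 1/(n+1). These are continuous, nonnegative and converge to the
    derivative at every positive point, which yields its sign, its measurability and the setting for
    Fatou. *)
Let slope (n : nat) (x : R) := n.+1%:R * (F (x + n.+1%:R^-1) - F x).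

Let slope_ge0 n x : 0 <= slope n x.
Proof. by rewrite mulr_ge0// subr_ge0 ndF// lerDl invr_ge0. Qed.

Let cvg_slope (x : R) : 0 < x -> slope n x @[n --> \oo] --> derive1 F x.
Proof.
move=> x0; have := dF _ x0; rewrite /derivable => /cvg_ex[/= l hl].
rewrite derive1E /derive (cvg_lim _ hl)//.
have /cvg_at_rightP := cvg_dnbhs_at_right hl.
move=> /(_ (fun n : nat => n.+1%:R^-1)) H.
rewrite (_ : (fun n => slope n x) =
  (fun n => n.+1%:R^-1^-1 *: (F (n.+1%:R^-1 *: 1 + x) - F x))); last first.
  by apply/funext => n; rewrite invrK /GRing.scale/= mulr1 [_ + x]addrC.
apply: H; split; first by move=> n; rewrite invr_gt0.
exact: cvg_harmonic.
Qed.

Let continuous_slope n : continuous (slope n).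
Proof.
move=> x; apply: cvgM; first exact: cvg_cst.
apply: cvgB; last exact: cF.
apply: (@cvg_comp _ _ _ (fun x => x + n.+1%:R^-1) F); last exact: cF.
by apply: cvgD; [exact: cvg_id|exact: cvg_cst].
Qed.

Lemma derive1_nondecreasing_ge0 (x : R) : 0 < x -> 0 <= derive1 F x.
Proof.
move=> /cvg_slope cx; rewrite -(cvg_lim _ cx)//.
by apply: limr_ge; [apply/cvg_ex; exists (derive1 F x)|near=> n; exact: slope_ge0].
Unshelve. all: by end_near. Qed.

Lemma measurable_derive1 :
  measurable_fun (`]0, +oo[%classic : set R) (derive1 F).
Proof.
apply: (measurable_fun_cvg (h := slope)).
  move=> n; apply: measurable_funTS; apply: continuous_measurable_fun.
  exact: continuous_slope.
by move=> x; rewrite /= in_itv/= andbT; exact: cvg_slope.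
Qed.

(** The base point -1 makes 0 an interior point, so that this primitive of [F] has a two-sided
    derivative at 0 too. *)
Let G (x : R) := \int[@lebesgue_measure R]_(t in `[-1, x]) F t.

Let is_derive_G (x : R) : -1 < x -> is_derive x 1 G (F x).
Proof.
move=> x1.
have iF : (@lebesgue_measure R).-integrable `[-1, x + 1] (EFin \o F).
  apply: continuous_compact_integrable; first exact: segment_compact.
  exact: continuous_subspaceT.
have xx1 : x < x + 1 by rewrite ltrDl.
have [dG GE] := continuous_FTC1_closed xx1 iF x1 (cF x).
by apply: DeriveDef => //; rewrite -derive1E.
Qed.

Let continuous_G (x : R) : -1 < x -> {for x, continuous G}.
Proof.
move=> /is_derive_G [dG _]; apply/differentiable_continuous.
exact/derivable1_diffP.
Qed.

Let increment_G (x e : R) : 0 < e -> 0 <= x ->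
  e * F x <= G (x + e) - G x <= e * F (x + e).
Proof.
move=> e0 x0; have xe : x < x + e by rewrite ltrDl.
have x1 : -1 < x by rewrite (lt_le_trans _ x0)// ltrN10.
have [|| c /[!in_itv]/= /andP[xc ce] ->] := @MVT R G F x (x + e) xe.
- move=> y /[!in_itv]/= /andP[xy _]; apply: is_derive_G; exact: lt_trans xy.
- apply: continuous_in_subspaceT => y; rewrite inE/= in_itv/= => /andP[xy _].
  by apply: continuous_G; exact: lt_le_trans xy.
by rewrite [x + e]addrC addrK [F c * e]mulrC !ler_pM2l// !ndF// ltW// addrC.
Qed.

(** With e = 1/(n+1), a primitive of the slope is [H] x = (G (x + e) - G x) / e, so the integral is
    [H] b - [H] 0. By monotonicity of [F], [H] b is at most F (b + e) and [H] 0 is at least F 0. *)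
Let integral_slope n (b : R) : 0 < b ->
  (\int[@lebesgue_measure R]_(x in `[0%R, b]) (slope n x)%:E <=
   (F (b + n.+1%:R^-1) - F 0)%:E)%E.
Proof.
move=> b0; set e : R := n.+1%:R^-1; have e0 : 0 < e by rewrite invr_gt0.
pose H x := n.+1%:R * (G (x + e) - G x).
have dH (x : R) : 0 <= x -> is_derive x 1 H (slope n x).
  move=> x0; have x1 : -1 < x by rewrite (lt_le_trans _ x0)// ltrN10.
  have xe1 : -1 < x + e by rewrite (lt_trans x1)// ltrDl.
  have := is_derive_G _ xe1; have := is_derive_G _ x1 => d1 d2.
  rewrite /H /slope -/e.
  have d3 : is_derive x 1 (fun x => G (x + e)) (F (x + e)).
    have := @is_derive1_comp R G (fun x => x + e) x _ 1 d2.
    rewrite mulr1; apply.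
    rewrite -[X in is_derive _ _ _ X]addr0.
    by apply: is_deriveD.
  have := is_deriveB d3 d1.
  have := @is_deriveZ R R _ (fun x => G (x + e) - G x) n.+1%:R x 1 _.
  by apply.
have cH (x : R) : 0 <= x -> {for x, continuous H}.
  by move=> /dH[+ _] => /derivable1_diffP/differentiable_continuous.
rewrite (@continuous_FTC2 R (slope n) H)//; last 3 first.
- by apply: continuous_subspaceT; exact: continuous_slope.
- split.
  + by move=> x /[!in_itv]/= /andP[/ltW/dH[]].
  + by apply: cvg_at_right_filter; exact: cH.
  + by apply: cvg_at_left_filter; apply: cH; exact: ltW.
- by move=> x /[!in_itv]/= /andP[/ltW/dH x0 _]; rewrite derive1E derive_val.
rewrite -EFinB lee_fin /H add0r.
have /andP[_ ub] := increment_G _ _ e0 (ltW b0).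
have /andP[lb _] := increment_G _ _ e0 (lexx 0).
rewrite add0r in lb.
have ne : n.+1%:R * e = 1 by rewrite divff.
have neM (y : R) : y = n.+1%:R * (e * y) by rewrite mulrA ne mul1r.
by apply: lerB; rewrite (neM (F _)) ler_pM2l.
Qed.

(* Fatou's lemma for the difference quotients; only the inequality is needed,
   which avoids absolute continuity. *)
Lemma integral_derive1_nondecreasing_le (b : R) : 0 <= b ->
  (\int[@lebesgue_measure R]_(x in `]0%R, b]) (derive1 F x)%:E <=
   (F b - F 0)%:E)%E.
Proof.
rewrite le_eqVlt => /predU1P[<-|b0].
  by rewrite set_itvoc0 integral_set0 subrr.
have inf_slope (x : R) : 0 < x ->
    limn_einf (fun n => (slope n x)%:E) = (derive1 F x)%:E.
  move=> /cvg_slope cx; have cex : (slope n x)%:E @[n --> \oo] --> (derive1 F x)%:E.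
    by apply: cvg_EFin => //; near=> n.
  by have [] := cvg_limn_einf_sup cex.
have -> : (\int[@lebesgue_measure R]_(x in `]0%R, b]) (derive1 F x)%:E =
    \int[@lebesgue_measure R]_(x in `]0%R, b])
      limn_einf (fun n => (slope n x)%:E))%E.
  by apply: eq_integral => x; rewrite inE/= in_itv/= => /andP[x0 _]; rewrite inf_slope.
have mslope n (A : set R) : measurable A -> measurable_fun A (EFin \o slope n).
  move=> mA; apply/measurable_EFinP/measurable_funTS.
  by apply: continuous_measurable_fun; exact: continuous_slope.
have mI : measurable (`]0%R, b]%classic : set R) by exact: measurable_itv.
apply: le_trans.
  apply: (@fatou _ _ R (@lebesgue_measure R) _ mI (fun n x => (slope n x)%:E)).
  - by move=> n; exact: mslope.
  - by move=> n x _; rewrite lee_fin.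
(* The bounds on the slope integrals overshoot [b] by 1/(n+1); continuity of [F] removes the
   overshoot in the limit. *)
have cv : (F (b + n.+1%:R^-1) - F 0)%:E @[n --> \oo] --> (F b - F 0)%:E.
  apply: cvg_EFin; first by near=> n.
  apply: cvgB; last exact: cvg_cst.
  have cb : b + n.+1%:R^-1 @[n --> \oo] --> b.
    rewrite -[X in _ --> X]addr0; apply: cvgD; first exact: cvg_cst.
    exact: cvg_harmonic.
  by apply: continuous_cvg => //; exact: cF.
rewrite -(cvg_lim _ cv)// limn_einf_lim.
apply: lee_lim; [exact: is_cvg_einfs|by apply/cvg_ex; eexists; exact: cv|].
near=> n; apply: (@le_trans _ _
  (\int[@lebesgue_measure R]_(x in `]0%R, b]) (slope n x)%:E)%E).
  by apply: ereal_inf_lbound; exists n => /=.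
apply: le_trans (integral_slope n _ b0).
apply: ge0_subset_integral => //.
- exact: mslope.
- by move=> x _; rewrite lee_fin.
- by apply: subset_itvr; rewrite bnd_simp.
Unshelve. all: by end_near. Qed.

End monotone_derivative.

(** * Tail probabilities of the estimation error and two-point testing *)

Section tail_probability.
Context (R : realType) (d1 d2 : measure_display)
  (Th : measurableType d1) (Yt : measurableType d2)
  (prior : probability Th R) (P : R.-pker Th ~> Yt)
  (beta : Th -> R) (betac : Yt -> R).
Hypotheses (mbeta : measurable_fun setT beta)
  (mbetac : measurable_fun setT betac).

Lemma measurable_kernel_section (A : set (Th * Yt)) : measurable A ->
  measurable_fun setT (fun x => P x [set y | A (x, y)]).
Proof.
move=> mA; have := @measurable_fun_xsection_finite_kernel _ _ _ _ _ P A.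
rewrite inE => /(_ mA); congr measurable_fun.
by apply/funext => x; rewrite xsectionE.
Qed.

Let mbeta1 : measurable_fun setT (fun z : Th * Yt => beta z.1).
Proof. exact: measurableT_comp. Qed.

Let mbetac2 : measurable_fun setT (fun z : Th * Yt => betac z.2).
Proof. exact: measurableT_comp. Qed.

Definition tail_event (t : R) (x : Th) : set Yt :=
  [set y | t <= 2 * `|betac y - beta x|].

Definition tail_prob (t : R) : \bar R := (\int[prior]_x P x (tail_event t x))%E.

Let over (t : R) (x : Th) : set Yt := [set y | beta x + t / 2 <= betac y].

(** Strict, whereas [over] is not: the two events are then disjoint even at t = 0, and the
    complement of [over] at theta lies in [under] at T theta as soon as beta (T theta) >= beta theta
    + t. *)
Let under (t : R) (x : Th) : set Yt := [set y | betac y < beta x - t / 2].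

Let mle (d : measure_display) (X : measurableType d) (g h : X -> R) :
  measurable_fun setT g -> measurable_fun setT h ->
  measurable [set x | g x <= h x].
Proof.
move=> mg mh; have := measurable_fun_le measurableT mg mh.
by rewrite setTI.
Qed.

Let mlt (d : measure_display) (X : measurableType d) (g h : X -> R) :
  measurable_fun setT g -> measurable_fun setT h ->
  measurable [set x | g x < h x].
Proof.
move=> mg mh; rewrite (_ : [set _ | _] = ~` [set x | h x <= g x]).
  by apply: measurableC; exact: mle.
by apply/seteqP; split => x /=; rewrite real_ltNge ?num_real// => /negP.
Qed.

Lemma measurable_tail_event t x : measurable (tail_event t x).
Proof.
apply: mle => //; apply: measurable_funM => //.
by apply: measurableT_comp => //; exact: measurable_funB.
Qed.

Let measurable_over t x : measurable (over t x).
Proof. exact: mle. Qed.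

Let measurable_under t x : measurable (under t x).
Proof. exact: mlt. Qed.

Lemma measurable_tail_prob t : measurable_fun setT (fun x => P x (tail_event t x)).
Proof.
apply: (@measurable_kernel_section
  [set z | t <= 2 * `|betac z.2 - beta z.1|]).
apply: mle => //; apply: measurable_funM => //.
by apply: measurableT_comp => //; exact: measurable_funB.
Qed.

Let measurable_P_over t : measurable_fun setT (fun x => P x (over t x)).
Proof.
apply: (@measurable_kernel_section [set z | beta z.1 + t / 2 <= betac z.2]).
by apply: mle => //; exact: measurable_funD.
Qed.

Let measurable_P_under t : measurable_fun setT (fun x => P x (under t x)).
Proof.
apply: (@measurable_kernel_section [set z | betac z.2 < beta z.1 - t / 2]).
by apply: mlt => //; exact: measurable_funB.
Qed.

Let P_over_under t x : 0 <= t ->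
  (P x (over t x) + P x (under t x) <= P x (tail_event t x))%E.
Proof.
move=> t0; rewrite -measureU//; last first.
  apply/seteqP; split => y //= [ov un]; have := le_lt_trans ov un.
  by apply/negP; rewrite -leNgt; lra.
apply: le_measure; rewrite ?inE//.
- exact: measurableU.
- exact: measurable_tail_event.
move=> y [] /=; rewrite /over /under /tail_event/= => yx.
- by rewrite ger0_norm; lra.
- by rewrite ltr0_norm; lra.
Qed.

Lemma tail_prob_nonincreasing t t' : t <= t' -> (tail_prob t' <= tail_prob t)%E.
Proof.
move=> tt'; apply: ge0_le_integral => //; do ?exact: measurable_tail_prob.
move=> x _; apply: le_measure; rewrite ?inE; do ?exact: measurable_tail_event.
by move=> y /=; exact: le_trans.
Qed.

(* Testing theta against T theta with the rule "betac >= beta theta + t/2": both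
   kinds of error force |betac - beta| >= t/2, since beta (T theta) >= beta theta + t. *)
Lemma integral_two_point_le (t : R) (Phi Phi' : set Th) (T : Th -> Th)
    (pit mu : {measure set Th -> \bar R}) (f ft : Th -> R) (c : R)
    (u : Th -> \bar R) :
  0 <= t -> measurable Phi -> measurable Phi' ->
  (forall x, Phi x -> Phi' (T x)) -> measurable_fun Phi T ->
  (forall S, measurable S ->
    prior (S `&` Phi') = pit (Phi `&` T @^-1` (S `&` Phi'))) ->
  {ae pit, forall x, Phi x -> beta x + t <= beta (T x)} ->
  measurable_fun Phi f -> measurable_fun Phi ft ->
  (forall x, Phi x -> 0 <= f x) -> (forall x, Phi x -> 0 <= ft x) ->
  (forall S, measurable S ->
    prior (S `&` Phi) = (\int[mu]_(x in S `&` Phi) (f x)%:E)%E) ->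
  (forall S, measurable S ->
    pit (S `&` Phi) = (\int[mu]_(x in S `&` Phi) (ft x)%:E)%E) ->
  0 <= c ->
  (forall x A, Phi x -> measurable A ->
    (u x <= c%:E * ((f x)%:E * P x A + (ft x)%:E * P (T x) (~` A)))%E) ->
  (\int[mu]_(x in Phi) u x <= c%:E * tail_prob t)%E.
Proof.
move=> t0 mPhi mPhi' PhiT mT priorT aebeta mf mft f0 ft0 priorE pitE c0 uP.
have mTS S : measurable S -> measurable (Phi `&` T @^-1` S) by move=> mS; exact: mT.
pose a x := P x (over t x); pose b x := P x (under t x).
have mbT : measurable_fun Phi (b \o T).
  by apply: measurableT_comp => //; exact: measurable_P_under.
have ma : measurable_fun Phi a.
  by apply: measurable_funTS; exact: measurable_P_over.
have mfa : measurable_fun Phi (fun x => (f x)%:E * a x)%E.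
  by apply: emeasurable_funM => //; exact/measurable_EFinP.
have mfb : measurable_fun Phi (fun x => (ft x)%:E * b (T x))%E.
  by apply: emeasurable_funM => //; exact/measurable_EFinP.
have fa0 x : Phi x -> (0 <= (f x)%:E * a x)%E.
  by move=> Phix; rewrite mule_ge0// lee_fin f0.
have fb0 x : Phi x -> (0 <= (ft x)%:E * b (T x))%E.
  by move=> Phix; rewrite mule_ge0// lee_fin ft0.
have mfab : measurable_fun Phi (fun x => (f x)%:E * a x + (ft x)%:E * b (T x))%E.
  exact: emeasurable_funD.
apply: (@le_trans _ _ (\int[mu]_(x in Phi)
    (c%:E * ((f x)%:E * a x + (ft x)%:E * b (T x))))%E).
  apply: le_integral_ae_majorant => //.
  - by apply: emeasurable_funM.
  - by move=> x Phix; rewrite mule_ge0 ?lee_fin// adde_ge0 ?fa0 ?fb0.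
  (* The shift inequality holds [pit]-almost everywhere, but the majorization must hold [mu]-almost
     everywhere. The exceptional set [M] is [pit]-null, so the density [ft] vanishes [mu]-almost
     everywhere on it and cancels the very term that needs the inequality. *)
  pose M := Phi `&` [set x | beta (T x) < beta x + t].
  have mM : measurable M.
    have mbe : measurable_fun Phi (EFin \o (beta \o T)).
      by apply/measurable_EFinP; exact: measurableT_comp.
    have mbt : measurable_fun Phi (EFin \o (fun x => beta x + t)).
      by apply/measurable_EFinP/measurable_funTS; exact: measurable_funD.
    by have := measurable_lte mPhi mbe mbt.
  have MPhi : M `&` Phi = M by apply: setIidl => x [].
  have pitM : pit M = 0%E.
    apply: measure_negligible => //; apply: negligibleS aebeta.
    by move=> x [Phix /= bx] /(_ Phix); rewrite leNgt bx.
  have mftM : measurable_fun M (EFin \o ft).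
    by apply/measurable_EFinP; apply: measurable_funS mft => // x [].
  have : ae_eq mu M (EFin \o ft) (cst 0%E).
    apply/ae_eq_integral_abs => //.
    rewrite -pitM -MPhi pitE// MPhi; apply: eq_integral => x.
    by rewrite inE => -[Phix _]; rewrite /= ger0_norm// ft0.
  apply: filterS => x Mft Phix.
  apply: (le_trans (uP x (over t x) Phix _)) => //.
  apply: lee_wpmul2l; first by rewrite lee_fin.
  apply: leeD => //.
  have [bx|bx] := ltP (beta (T x)) (beta x + t).
    by have := Mft (conj Phix bx) => /= ->; rewrite !mul0e.
  apply: lee_wpmul2l; first by rewrite lee_fin ft0.
  apply: le_measure; rewrite ?inE//; first exact: measurableC.
  by move=> y /= /negP; rewrite /over /under/= -ltNge; lra.
rewrite ge0_integralZl//; last first.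
  by move=> x Phix; rewrite adde_ge0 ?fa0 ?fb0.
apply: lee_wpmul2l; first by rewrite lee_fin.
rewrite ge0_integralD//.
(* The density [f] against [mu] gives the prior restricted to [Phi], which is at most the prior. *)
have Ea : (\int[mu]_(x in Phi) ((f x)%:E * a x) <= \int[prior]_x a x)%E.
  have mrE S : measurable S -> mrestr prior mPhi S =
      (\int[mu]_(x in Phi `&` id @^-1` S) (f x)%:E)%E.
    by move=> mS; rewrite /mrestr priorE// setIC.
  have := @ge0_integral_weighted_image _ _ _ _ _ mu (mrestr prior mPhi) Phi id f a.
  move=> <- //; last exact: measurable_P_over.
  apply: ge0_le_measure_integral => //; last exact: measurable_P_over.
  by move=> S mS; apply: le_measure; rewrite ?inE//; exact: measurableI.
(* Here the image under [T] of the measure with density [ft] is the prior restricted to [Phi'], so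
   underestimation at T theta also becomes an average over the prior. *)
have Eb : (\int[mu]_(x in Phi) ((ft x)%:E * b (T x)) <= \int[prior]_x b x)%E.
  have mrE S : measurable S -> mrestr prior mPhi' S =
      (\int[mu]_(x in Phi `&` T @^-1` S) (ft x)%:E)%E.
    move=> mS; rewrite /mrestr priorT//.
    have -> : Phi `&` T @^-1` (S `&` Phi') = (Phi `&` T @^-1` S) `&` Phi.
      by apply/seteqP; split => x /= [] => [Phix []|[Phix]] => //; split => //;
        split => //; exact: PhiT.
    by rewrite pitE; [rewrite setIAC setIid|exact: mTS].
  have := @ge0_integral_weighted_image _ _ _ _ _ mu (mrestr prior mPhi') Phi T ft b.
  move=> <- //; last exact: measurable_P_under.
  apply: ge0_le_measure_integral => //; last exact: measurable_P_under.
  by move=> S mS; apply: le_measure; rewrite ?inE//; exact: measurableI.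
apply: (le_trans (leeD Ea Eb)).
rewrite -ge0_integralD//; [|exact: measurable_P_over|exact: measurable_P_under].
apply: ge0_le_integral => //.
- by move=> x _; rewrite adde_ge0.
- apply: emeasurable_funD; [exact: measurable_P_over|exact: measurable_P_under].
- exact: measurable_tail_prob.
- by move=> x _; exact: P_over_under.
Qed.

End tail_probability.

(** * The rescaled loss and its derivative as a weight *)

Section loss_function.
Context (R : realType) (D : R -> R).
Hypotheses (ndD : forall x y : R, 0 <= y -> y <= x -> D y <= D x)
  (D0 : D 0 = 0) (dD : forall x : R, 0 < x -> derivable D x 1)
  (rD : exists l : R, h^-1 * (D h - D 0) @[h --> 0^'+] --> l).

(* Cut off at 0 because D is unconstrained on the negative reals. *)
Definition half_loss (x : R) : R := D (Num.max (x / 2) 0).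

(** Right differentiability at 0 gives right continuity: D h - D 0 is h times a quotient with a
    finite limit. *)
Let D_at_right : D x @[x --> 0^'+] --> D 0.
Proof.
have [l hl] := rD.
have : h * (h^-1 * (D h - D 0)) + D 0 @[h --> 0^'+] --> 0 * l + D 0.
  apply: cvgD; last exact: cvg_cst.
  by apply: cvgM => //; apply: cvg_at_right_filter; exact: cvg_id.
rewrite mul0r add0r; apply: cvg_trans; apply: near_eq_cvg; near=> h.
have h0 : h != 0 by rewrite gt_eqF//; near: h; exact: nbhs_right_gt.
by rewrite mulrA divff// mul1r subrK.
Unshelve. all: by end_near. Qed.

Let Dmax (x : R) : R := D (Num.max x 0).

Let near_Dmax (x : R) : 0 < x -> \near x, D x = Dmax x.
Proof.
move=> x0; near=> y; rewrite /Dmax max_l//; apply: ltW.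
by near: y; exact: lt_nbhsr.
Unshelve. all: by end_near. Qed.

(** The function is constant to the left of 0 and differentiable to the right; the pieces fit
    together at 0 by [D_at_right]. *)
Let continuous_Dmax : continuous Dmax.
Proof.
move=> x; rewrite /continuous_at; have [x0|x0|->] := ltgtP x 0.
- have : cst (D 0) y @[y --> x] --> D 0 by exact: cvg_cst.
  have -> : Dmax x = D 0 by rewrite /Dmax max_r// ltW.
  apply: cvg_trans; apply: near_eq_cvg.
  near=> y; rewrite /Dmax max_r//; apply: ltW.
  by near: y; exact: lt_nbhsl.
- have : {for x, continuous D}.
    exact/differentiable_continuous/derivable1_diffP/dD.
  have -> : Dmax x = D x by rewrite /Dmax max_l// ltW.
  apply: cvg_trans; apply: near_eq_cvg.
  exact: near_Dmax.
- have Dmax0 : Dmax 0 = D 0 by rewrite /Dmax maxxx.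
  apply/left_right_continuousP; rewrite Dmax0; split.
  + have : cst (D 0) y @[y --> (0 : R)^'-] --> D 0 by exact: cvg_cst.
    apply: cvg_trans; apply: near_eq_cvg; near=> y.
    have y0 : y <= 0 by near: y; exact: nbhs_left_le.
    by rewrite /Dmax max_r.
  + apply: cvg_trans D_at_right; apply: near_eq_cvg; near=> y.
    by rewrite /Dmax max_l//; near: y; exact: nbhs_right_ge.
Unshelve. all: by end_near. Qed.

Lemma continuous_half_loss : continuous half_loss.
Proof.
move=> x; apply: (@cvg_comp _ _ _ (fun x => x / 2) Dmax); last exact: continuous_Dmax.
by apply: cvgM; [exact: cvg_id|exact: cvg_cst].
Qed.

Lemma half_loss_nondecreasing : {homo half_loss : x y / (x <= y)%R}.
Proof.
move=> x y xy; apply: ndD; first by rewrite le_max lexx orbT.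
by rewrite ge_max !le_max lexx orbT andbT ler_pM2r ?xy.
Qed.

Let is_derive_half_loss (x : R) : 0 < x ->
  is_derive x 1 half_loss (derive1 D (x / 2) / 2).
Proof.
move=> x0; have x20 : 0 < x / 2 by rewrite divr_gt0.
have d1 : is_derive (x / 2) 1 Dmax (derive1 D (x / 2)).
  apply: (near_eq_is_derive (near_Dmax _ x20)); rewrite derive1E.
  by apply: DeriveDef => //; exact: dD.
have d2 : is_derive x 1 (fun x : R => x / 2) 2^-1.
  rewrite (_ : (fun x : R => x / 2) = 2^-1 *: (@id R)).
    by rewrite -[X in is_derive _ _ _ X]mulr1; exact: is_deriveZ.
  by apply/funext => y /=; rewrite mulrC.
exact: (@is_derive1_comp R Dmax (fun x => x / 2) x _ _ d1 d2).
Qed.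

Lemma derivable_half_loss (x : R) : 0 < x -> derivable half_loss x 1.
Proof. by case/is_derive_half_loss. Qed.

Lemma derive1_half_loss (x : R) : 0 < x ->
  derive1 half_loss x = derive1 D (x / 2) / 2.
Proof. by case/is_derive_half_loss => _ <-; rewrite derive1E. Qed.

Lemma half_lossM2 (x : R) : 0 <= x -> half_loss (2 * x) = D x.
Proof. by move=> x0; rewrite /half_loss mulrAC divff// mul1r max_l. Qed.

Lemma half_loss0 : half_loss 0 = 0.
Proof. by rewrite /half_loss mul0r maxxx. Qed.

(* At t = 0 the two-sided derivative of D is a junk value, hence the restriction. *)
Definition loss_weight (t : R) : R :=
  (derive1 half_loss \_ (`]0, +oo[%classic : set R)) t.

Lemma loss_weight_ge0 t : 0 <= loss_weight t.
Proof.
rewrite /loss_weight patchE; case: ifPn => //; rewrite inE/= in_itv/= andbT => t0.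
apply: derive1_nondecreasing_ge0 => //.
- exact: half_loss_nondecreasing.
- exact: derivable_half_loss.
Qed.

Lemma measurable_loss_weight : measurable_fun setT loss_weight.
Proof.
have mI : measurable (`]0%R, +oo[%classic : set R) by exact: measurable_itv.
have [mr _] := measurable_restrictT (derive1 half_loss) mI; apply: mr.
exact: (@measurable_derive1 R half_loss continuous_half_loss
  derivable_half_loss).
Qed.

(** Since D e = [half_loss] (2 e) and [half_loss] 0 = 0, this is the derivative inequality for
    [half_loss] on ]0, 2 e]. The indicator in [t] encodes the upper limit, so that it can later be
    read as the tail event. *)
Lemma integral_loss_weight_le (e : R) : 0 <= e ->
  (\int[@lebesgue_measure R]_t
     (loss_weight t * \1_[set t : R | t <= 2 * e] t)%:E <= (D e)%:E)%E.
Proof.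
move=> e0; rewrite -half_lossM2// -[half_loss _]subr0 -half_loss0.
apply: le_trans (integral_derive1_nondecreasing_le _ _ _ _ _ _ _); last first.
- by rewrite mulr_ge0.
- exact: derivable_half_loss.
- exact: half_loss_nondecreasing.
- exact: continuous_half_loss.
rewrite [leRHS]integral_mkcond le_eqVlt; apply/orP; left; apply/eqP.
apply: eq_integral => t _; rewrite /loss_weight !patchE indicE.
have -> : (t \in `]0, 2 * e]%classic) =
  (t \in `]0, +oo[%classic) && (t \in [set t | t <= 2 * e]).
  apply/idP/andP => [|[]]; rewrite !inE/= !in_itv/= ?andbT; last by move=> -> ->.
  by move/andP.
by case: ifPn => t1; case: (t \in [set _ | _]); rewrite ?mulr1 ?mulr0 ?mul0r.
Qed.

End loss_function.

Arguments tail_event {R d1 d2 Th Yt} beta betac t x.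
Arguments tail_prob {R d1 d2 Th Yt} prior P beta betac t.
Arguments half_loss {R} D x.
Arguments loss_weight {R} D t.

(** * From tail probabilities to the Bayesian risk *)

Section bayes_risk.
Context (R : realType) (d1 d2 : measure_display)
  (Th : measurableType d1) (Yt : measurableType d2)
  (prior : probability Th R) (P : R.-pker Th ~> Yt)
  (beta : Th -> R) (betac : Yt -> R) (D : R -> R).
Hypotheses (mbeta : measurable_fun setT beta)
  (mbetac : measurable_fun setT betac).
Hypotheses (ndD : forall x y : R, 0 <= y -> y <= x -> D y <= D x)
  (D0 : D 0 = 0) (dD : forall x : R, 0 < x -> derivable D x 1)
  (rD : exists l : R, h^-1 * (D h - D 0) @[h --> 0^'+] --> l).

Let mu := @lebesgue_measure R.

Let tail_set : set (R * Th * Yt) :=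
  [set z | z.1.1 <= 2 * `|betac z.2 - beta z.1.2|].

Let mtail_set : measurable tail_set.
Proof.
rewrite -[tail_set]setTI; apply: measurable_fun_le => //.
  exact: measurableT_comp.
apply: measurable_funM => //; apply: measurableT_comp => //.
by apply: measurable_funB; apply: measurableT_comp => //; exact: measurableT_comp.
Qed.

Let tail_probE t x :
  P x (tail_event beta betac t x) = (\int[P x]_y (\1_tail_set (t, x, y))%:E)%E.
Proof.
have -> : (\int[P x]_y (\1_tail_set (t, x, y))%:E =
           \int[P x]_y (\1_(tail_event beta betac t x) y)%:E)%E.
  by apply: eq_integral => y _; rewrite !indicE.
by rewrite integral_indic// ?setIT//; exact: measurable_tail_event.
Qed.

Lemma measurable_tail_prob_threshold :
  measurable_fun setT (tail_prob prior P beta betac).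
Proof.
have mk : measurable_fun setT (fun z : R * Th * Yt => (\1_tail_set z)%:E : \bar R).
  by apply/measurable_EFinP; exact: measurable_indic.
have k0 z : (0 <= (\1_tail_set z)%:E :> \bar R)%E by rewrite lee_fin.
have mi := measurable_integral_kernel_snd _ _ _ _ _ _ _ P _ mk k0.
rewrite (_ : tail_prob prior P beta betac = fubini_F prior
    (fun z : R * Th => \int[P z.2]_y (\1_tail_set (z, y))%:E)%E).
  by apply: measurable_fun_fubini_tonelli_F => // z; exact: integral_ge0.
by apply/funext => t; apply: eq_integral => x _; rewrite tail_probE.
Qed.

(** Expanding the tail probability as an integral of indicators and applying Tonelli puts the [t]
    integral innermost, where [integral_loss_weight_le] bounds it by the loss at e = |betac y - beta
    x|. *)
Lemma integral_loss_weight_tail_prob_le :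
  (\int[mu]_t ((loss_weight D t)%:E * tail_prob prior P beta betac t) <=
   \int[prior]_x \int[P x]_y (D `|betac y - beta x|)%:E)%E.
Proof.
have w0 := loss_weight_ge0 _ _ ndD dD.
have mw := measurable_loss_weight _ _ dD rD.
pose k (z : R * Th * Yt) : \bar R := (loss_weight D z.1.1 * \1_tail_set z)%:E.
have mk : measurable_fun setT k.
  apply/measurable_EFinP; apply: measurable_funM; last exact: measurable_indic.
  by apply: (measurableT_comp mw); exact: measurableT_comp.
have k0 z : (0 <= k z)%E by rewrite lee_fin mulr_ge0.
have -> : (\int[mu]_t ((loss_weight D t)%:E * tail_prob prior P beta betac t) =
           \int[mu]_t \int[prior]_x \int[P x]_y k (t, x, y))%E.
  apply: eq_integral => t _; rewrite -ge0_integralZl//; last 2 first.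
    exact: measurable_tail_prob.
    by rewrite lee_fin.
  apply: eq_integral => x _; rewrite tail_probE -ge0_integralZl//.
  - apply/measurable_EFinP; apply: (measurableT_comp (measurable_indic mtail_set)).
    exact: measurable_fun_pair.
  - by rewrite lee_fin.
rewrite (@tonelli_kernel _ _ _ _ _ _ _ mu prior P)//.
have mloss : measurable_fun setT
    (fun z : Th * Yt => (D `|betac z.2 - beta z.1|)%:E).
  (* [D] is uncontrolled on the negative reals, so measurability is obtained through the continuous
     function [half_loss], evaluated at twice the error. *)
  rewrite (_ : (fun _ => _) = EFin \o
    (half_loss D \o (fun z : Th * Yt => 2 * `|betac z.2 - beta z.1|))); last first.
    by apply/funext => z /=; rewrite half_lossM2.
  apply/measurable_EFinP; apply: measurableT_comp.
    apply: continuous_measurable_fun; exact: continuous_half_loss.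
  apply: measurable_funM => //; apply: measurableT_comp => //.
  by apply: measurable_funB; exact: measurableT_comp.
have D_ge0 x : 0 <= x -> 0 <= D x by move=> x0; rewrite -D0 ndD.
apply: le_integral_ae_majorant => //.
- apply: (@measurable_fun_integral_finite_kernel _ _ _ _ _
    (fun z => (D `|betac z.2 - beta z.1|)%:E) P) => // z.
  by rewrite lee_fin D_ge0.
- by move=> x _; apply: integral_ge0 => y _; rewrite lee_fin D_ge0.
apply: aeW => x _; apply: le_integral_ae_majorant => //.
- have mx : measurable_fun setT (fun y : Yt => (x, y)) by exact: measurable_fun_pair.
  exact: (measurableT_comp mloss mx).
- by move=> y _; rewrite lee_fin D_ge0.
apply: aeW => y _.
apply: le_trans (integral_loss_weight_le _ _ ndD D0 dD rD _ (normr_ge0 _)).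
rewrite le_eqVlt; apply/orP; left; apply/eqP; apply: eq_integral => t _.
by rewrite /k/= !indicE; congr (_ * (nat_of_bool _)%:R)%:E; apply/idP/idP; rewrite !inE.
Qed.

(** For t' >= t >= 0, g t' is at most the tail probability at t', hence at most the one at t; taking
    the supremum over t' bounds the valley-filled function. *)
Lemma valley_fill_risk_le (g : R -> \bar R) :
  (forall t, 0 <= t -> (g t <= tail_prob prior P beta betac t)%E) ->
  (2^-1%:E * \int[mu]_(t in `[0%R, +oo[%classic)
       ((derive1 D (t / 2))%:E * valley_fill g t) <=
   \int[prior]_x \int[P x]_y (D `|betac y - beta x|)%:E)%E.
Proof.
move=> gle; apply: le_trans integral_loss_weight_tail_prob_le.
have w0 := loss_weight_ge0 _ _ ndD dD.
have mw := measurable_loss_weight _ _ dD rD.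
have tail0 t : (0 <= tail_prob prior P beta betac t)%E by exact: integral_ge0.
have mtail := measurable_tail_prob_threshold.
have mI : measurable (`[0%R, +oo[%classic : set R) by exact: measurable_itv.
(* For t > 0, [loss_weight] is D'(t/2) / 2; doubling it recovers D'(t/2) and leaves the factor 1/2
   in front of the integral. *)
pose w t := ((2 * loss_weight D t)%:E * tail_prob prior P beta betac t)%E.
have mw2 : measurable_fun setT w.
  by apply: emeasurable_funM => //; apply/measurable_EFinP; exact: measurable_funM.
have ww0 t : (0 <= w t)%E by rewrite mule_ge0// lee_fin mulr_ge0.
have -> : (\int[mu]_t ((loss_weight D t)%:E * tail_prob prior P beta betac t) =
    2^-1%:E * \int[mu]_t w t)%E.
  rewrite -ge0_integralZl//.
  by apply: eq_integral => t _; rewrite /w muleA -EFinM mulrA mulVf// mul1r.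
apply: lee_wpmul2l; first by rewrite lee_fin.
apply: (@le_trans _ _ (\int[mu]_(t in `[0%R, +oo[%classic) w t)%E); last first.
  exact: ge0_subset_integral.
apply: le_integral_ae_majorant => //; first exact: measurable_funTS.
(* The comparison may fail only at t = 0, where [derive1 D] is not controlled; a single point is
   Lebesgue-null. *)
exists [set 0]; split; [by []|exact: lebesgue_measure_set1|].
move=> t /=; apply: contra_notP => /eqP tn0; rewrite in_itv/= andbT => t0.
have tgt0 : 0 < t by rewrite lt_neqAle eq_sym tn0.
have wE : loss_weight D t = derive1 D (t / 2) / 2.
  rewrite /loss_weight patchE mem_set/= ?in_itv/= ?tgt0//.
  exact: derive1_half_loss.
rewrite /w wE [2 * _]mulrC divfK//.
apply: lee_wpmul2l.
  by rewrite lee_fin; have := w0 t; rewrite wE pmulr_lge0.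
apply: ge_ereal_sup => _ [t' /= + <-]; rewrite in_itv/= andbT => tt'.
apply: (le_trans (gle _ (le_trans t0 tt'))).
exact: tail_prob_nonincreasing.
Qed.

End bayes_risk.

(** * Minimum error probabilities and the two lower bounds *)

Lemma min_err_le (R : realType) (d1 d2 : measure_display)
    (Th : measurableType d1) (Yt : measurableType d2) (P : R.-pker Th ~> Yt)
    (theta phi : Th) (q : R) (A : set Yt) : measurable A ->
  (min_err P theta phi q <= q%:E * P theta A + (1 - q)%:E * P phi (~` A))%E.
Proof. by move=> mA; apply: ereal_inf_lbound; exists A. Qed.

Theorem theorem1 (R : realType) (d1 d2 : measure_display)
  (Th : measurableType d1) (Yt : measurableType d2)
  (H1 : borel_space R Th) (H2 : borel_space R Yt)
  (prior : probability Th R) (P : R.-pker Th ~> Yt)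
  (beta : Th -> R) (betac : Yt -> R)
  (H3 : measurable_fun setT beta) (H4 : measurable_fun setT betac)
  (D : R -> R)
  (H5 : forall x y : R, 0 <= y -> y <= x -> D y <= D x)
  (H6 : D 0 = 0)
  (H7 : forall x : R, 0 < x -> derivable D x 1)
  (H8 : exists l : R, h^-1 * (D h - D 0) @[h --> 0^'+] --> l)
  (Phi Phi' : R -> set Th) (T : R -> Th -> Th)
  (pit : R -> {measure set Th -> \bar R})
  (mu : R -> {measure set Th -> \bar R})
  (f ft : R -> Th -> R)
  (H9 : forall t : R, 0 <= t -> measurable (Phi t) /\ measurable (Phi' t))
  (H10 : forall t : R, 0 <= t -> forall x, Phi t x -> Phi' t (T t x))
  (H11 : forall t : R, 0 <= t -> measurable_fun (Phi t) (T t))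
  (H12 : forall t : R, 0 <= t -> pit t (~` Phi t) = 0%E)
  (H13 : forall t : R, 0 <= t -> forall S : set Th, measurable S ->
         prior (S `&` Phi' t) = pit t (Phi t `&` T t @^-1` (S `&` Phi' t)))
  (H14 : forall t : R, 0 <= t ->
         {ae pit t, forall x, Phi t x -> beta x + t <= beta (T t x)})
  (H15 : forall t : R, 0 <= t -> mu t (~` Phi t) = 0%E)
  (H16 : forall t : R, 0 <= t -> measurable_fun (Phi t) (f t) /\
         measurable_fun (Phi t) (ft t))
  (H17 : forall t : R, 0 <= t -> forall x, Phi t x -> 0 <= f t x /\ 0 <= ft t x)
  (H18 : forall t : R, 0 <= t -> forall S : set Th, measurable S ->
         prior (S `&` Phi t) = (\int[mu t]_(x in S `&` Phi t) (f t x)%:E)%E)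
  (H19 : forall t : R, 0 <= t -> forall S : set Th, measurable S ->
         pit t (S `&` Phi t) = (\int[mu t]_(x in S `&` Phi t) (ft t x)%:E)%E) :
  let E := (\int[prior]_x \int[P x]_y (D `|betac y - beta x|)%:E)%E in
  let g1 := fun t : R =>
    (\int[mu t]_(x in Phi t)
        ((f t x + ft t x)%:E
         * min_err P x (T t x) (f t x / (f t x + ft t x))))%E in
  let g2 := fun t : R =>
    (2%:E * \int[mu t]_(x in Phi t)
        ((Num.min (f t x) (ft t x))%:E * min_err P x (T t x) (2^-1)))%E in
  let Z1 := (2^-1%:E * \int[@lebesgue_measure R]_(t in `[0%R, +oo[%classic)
        ((derive1 D (t / 2))%:E * valley_fill g1 t))%E in
  let Z2 := (2^-1%:E * \int[@lebesgue_measure R]_(t in `[0%R, +oo[%classic)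
        ((derive1 D (t / 2))%:E * valley_fill g2 t))%E in
  (Z1 <= E)%E /\ (Z2 <= E)%E.
Proof.
move=> E g1 g2 Z1 Z2.
split; apply: valley_fill_risk_le => // t t0;
  have [mPhi mPhi'] := H9 t t0; have [mf mft] := H16 t t0;
  have f0 x Px := (H17 t t0 x Px).1; have ft0 x Px := (H17 t t0 x Px).2;
  have two_point := integral_two_point_le _ _ _ _ _ prior P _ _ H3 H4 t
    (Phi t) (Phi' t) (T t) (pit t) (mu t) (f t) (ft t) _ _ t0 mPhi mPhi'
    (H10 t t0) (H11 t t0) (H13 t t0) (H14 t t0) mf mft f0 ft0
    (H18 t t0) (H19 t t0).
(* First bound, with c = 1: multiplying the testing prior q = f/(f + ft) and its complement by f +
   ft gives back exactly f and ft. *)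
- rewrite -[leRHS]mul1e; apply: two_point => // x A Phix mA.
  have fx := f0 x Phix; have ftx := ft0 x Phix; rewrite mul1e.
  (* When both densities vanish, q is 0/0, but the weight f + ft cancels its term. *)
  have [s0|s0] := eqVneq (f t x + ft t x) 0.
    by rewrite s0 mul0e adde_ge0// mule_ge0// lee_fin.
  apply: (@le_trans _ _ ((f t x + ft t x)%:E *
    ((f t x / (f t x + ft t x))%:E * P x A +
     (1 - f t x / (f t x + ft t x))%:E * P (T t x) (~` A)))%E).
    apply: lee_wpmul2l; first by rewrite lee_fin addr_ge0.
    exact: min_err_le.
  have q0 : 0 <= f t x / (f t x + ft t x) by rewrite divr_ge0 ?addr_ge0.
  have q1 : 1 - f t x / (f t x + ft t x) = ft t x / (f t x + ft t x).
    by apply: (mulIf s0); rewrite mulrBl mul1r !divfK// [X in X - _]addrC addrK.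
  rewrite q1 ge0_muleDr ?mule_ge0 ?lee_fin ?divr_ge0 ?addr_ge0//.
  by rewrite !muleA -!EFinM ![(f t x + ft t x) * _]mulrC !divfK.
(* Second bound, with c = 1/2: both testing priors equal 1/2 and the minimum of the densities is at
   most each of them. The factor 2 in [g2] compensates c. *)
- rewrite [leRHS](_ : _ =
    2%:E * (2^-1%:E * tail_prob prior P beta betac t))%E; last first.
    by rewrite muleA -EFinM divff// mul1e.
  apply: lee_wpmul2l; first by rewrite lee_fin.
  apply: two_point => [|x A Phix mA]; first by [].
  have fx := f0 x Phix; have ftx := ft0 x Phix.
  have m0 : 0 <= Num.min (f t x) (ft t x) by rewrite le_min fx ftx.
  apply: (@le_trans _ _ ((Num.min (f t x) (ft t x))%:E *
    (2^-1%:E * P x A + (1 - 2^-1)%:E * P (T t x) (~` A)))%E).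
    apply: lee_wpmul2l; first by rewrite lee_fin.
    exact: min_err_le.
  have -> : (1 - 2^-1 = 2^-1 :> R) by lra.
  rewrite -ge0_muleDr// muleCA lee_wpmul2l ?lee_fin//.
  rewrite ge0_muleDr//; apply: leeD; apply: lee_wpmul2r => //;
    by rewrite lee_fin ge_min lexx ?orbT.
Qed.
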